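(* Let $g\geq 1$ and let $D(g)$ be the $g$-th generation of the deterministic scale-free network (DSFN), with vertex set $\{1,2,\dots,3^g\}$. Then the minimal perfect critical sets of $D(g)$ are exactly the sets $\{3k-1,3k\}$, $k=1,2,\dots,3^{g-1}$. Consequently, the minimum number of leaders that render $D(g)$ controllable is $n_l=3^{g-1}$, and the number of leader sets of size $n_l$ under which $D(g)$ is controllable is $n_s=2^{n_l}$.
   Context: Construction of the DSFN: $D(0)$ is the single vertex $1$, which is both its root and its only bottom vertex. For $g\geq 0$, $D(g+1)$ consists of $D(g)$ on $\{1,\dots,3^g\}$, together with two disjoint copies of $D(g)$ whose vertices are labeled by shifting the labels by $3^g$ and by $2\cdot 3^g$ respectively, and with additional edges joining vertex $1$ (the root) to every bottom vertex of the two new copies. The bottom vertices of $D(g+1)$ are the bottom vertices of the two new copies. (Thus $D(1)$ has edges $12,13$; in $D(2)$ vertex $1$ is adjacent to $2,3,5,6,8,9$, vertex $4$ to $5,6$, and vertex $7$ to $8,9$.) For a graph $G=(V,E)$ with Laplacian $\mathbf{L}$ (degree matrix minus adjacency matrix), a nonempty set $S\subseteq V$ is a perfect critical set (PCS) if there is an eigenvector $\mathbf{y}$ of $\mathbf{L}$ with $\mathbf{y}_v=0$ for all $v\notin S$ and $\mathbf{y}_v\ne0$ for all $v\in S$; it is a minimal perfect critical set if it is a PCS and no proper subset of it is a PCS. For a follower set $F\subseteq V$ with leader set $\overline F=V\setminus F$, let $\mathbf{A}=\mathbf{L}_{F\to F}$ be the submatrix of $\mathbf{L}$ with rows and columns in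 $F$, and $\mathbf{B}=\mathbf{L}_{F\to\overline F}$ the submatrix with rows in $F$ and columns in $\overline F$. $G$ is controllable under the leader set $\overline F$ if $[\mathbf{B},\mathbf{A}\mathbf{B},\dots,\mathbf{A}^{N-1}\mathbf{B}]$ has full row rank, $N=|F|$; equivalently, no eigenvector of $\mathbf{L}$ vanishes on all of $\overline F$. *)

(* Defs.v *)
From HB Require Import structures.
From mathcomp Require Import all_boot all_order all_algebra.
From mathcomp Require Import reals.

Set Implicit Arguments.
Unset Strict Implicit.
Unset Printing Implicit Defensive.

Import GRing.Theory Num.Theory.

Section Dsfn.

Local Open Scope nat_scope.

(* Vertices are handled through their labels 1, ..., 3 ^ g. *)
Definition shift_labels (d : nat) (s : seq nat) : seq nat :=
  [seq d + v | v <- s].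

Definition shift_edges (d : nat) (s : seq (nat * nat)) : seq (nat * nat) :=
  [seq (d + uv.1, d + uv.2) | uv <- s].

Fixpoint dsfn_bottom (g : nat) : seq nat :=
  if g is h.+1 then
    shift_labels (3 ^ h) (dsfn_bottom h)
      ++ shift_labels (2 * 3 ^ h) (dsfn_bottom h)
  else [:: 1].

Fixpoint dsfn_edges (g : nat) : seq (nat * nat) :=
  if g is h.+1 then
    dsfn_edges h
      ++ shift_edges (3 ^ h) (dsfn_edges h)
      ++ shift_edges (2 * 3 ^ h) (dsfn_edges h)
      ++ [seq (1, b) | b <- dsfn_bottom h.+1]
  else [::].

(* The ordinal i : 'I_n stands for the vertex labeled i + 1. *)
Definition label (n : nat) (i : 'I_n) : nat := i.+1.

(* dsfn_edges lists each edge in one orientation only. *)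
Definition dsfn (g : nat) : rel 'I_(3 ^ g) := fun u v =>
  ((label u, label v) \in dsfn_edges g)
  || ((label v, label u) \in dsfn_edges g).

End Dsfn.

Arguments dsfn : clear implicits.

Section GraphControl.

Local Open Scope ring_scope.

Variables (R : realType) (n : nat) (e : rel 'I_n).

Definition degree_mx : 'M[R]_n := diag_mx (\row_i #|[set j | e i j]|%:R).

Definition adjacency_mx : 'M[R]_n := \matrix_(i, j) (e i j)%:R.

Definition laplacian : 'M[R]_n := degree_mx - adjacency_mx.

Definition is_eigenvector (M : 'M[R]_n) (y : 'cV[R]_n) : Prop :=
  y != 0 /\ exists a : R, M *m y = a *: y.

Definition pcs (S : {set 'I_n}) : Prop :=
  S != set0 /\
  exists y : 'cV[R]_n,
    [/\ is_eigenvector laplacian y,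
        forall v, v \notin S -> y v 0 = 0
      & forall v, v \in S -> y v 0 != 0].

Definition minimal_pcs (S : {set 'I_n}) : Prop :=
  pcs S /\ forall S' : {set 'I_n}, S' \proper S -> ~ pcs S'.

(* The rows and columns in a set are listed in increasing order. *)
Definition submx_on (P Q : {set 'I_n}) (M : 'M[R]_n) : 'M[R]_(#|P|, #|Q|) :=
  mxsub (fun i : 'I_#|P| => enum_val i) (fun j : 'I_#|Q| => enum_val j) M.

(* W is the leader set, its complement the follower set. *)
Definition controllable (W : {set 'I_n}) : bool :=
  let F := ~: W in
  let A := submx_on F F laplacian in
  let B := submx_on F W laplacian in
  row_free (\mxrow_(k < #|F|) (A ^+ k *m B)).

End GraphControl.

(* Main.v *)
Require Import Defs.
From HB Require Import structures.
From mathcomp Require Import all_boot all_order all_algebra.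
From mathcomp Require Import reals zify.

Set Implicit Arguments.
Unset Strict Implicit.
Unset Printing Implicit Defensive.

Import GRing.Theory.

(** For g >= 1 the network D(g) is bipartite.  The vertices whose label is 1
    modulo 3 are the hubs, the others are the leaves, and the leaves come in
    pairs of twins {3k - 1, 3k} with the same neighbours.  Each hub 3k - 2 is
    adjacent to its own pair {3k - 1, 3k}, and every other neighbour of a leaf
    is an earlier hub: the hub-by-pair adjacency matrix is unitriangular
    ([dsfn_twin_triangular]).  The results then hold for every graph of this
    shape, which is the record [twin_triangular].

    The difference of the two unit vectors of a pair is an eigenvector of the
    Laplacian L, so every pair is a perfect critical set, and a leader set
    must meet every pair.  Conversely, let W meet every pair and let y, Ly and
    LLy vanish on W.  At a leaf of W the equation (Ly)(leaf) = 0 says that y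
    sums to zero over the neighbouring hubs, and unitriangularity gives y = 0
    on all hubs ([hubs_vanish]).  The same holds for Ly in place of y; so at
    every hub y sums to zero over the neighbouring leaves, and the transposed
    triangular system, with one leaf of each pair known to be zero, gives
    y = 0 on all leaves ([leaves_vanish]).

    An eigenvector that vanishes on W satisfies these conditions, so the
    support of every eigenvector contains a pair, which determines the minimal
    perfect critical sets.  A row vector that kills B and AB, extended by
    zero on W, satisfies them too, so D(g) is controllable under W
    ([controllable_of_observable]).  Hence the controlling leader sets are
    the sets that meet each of the 3 ^ (g - 1) disjoint pairs, and the smallest
    ones choose one vertex in each pair. *)

(** * Leader sets and vectors that vanish on them *)

Section Control.

Local Open Scope ring_scope.

Variables (R : realType) (n : nat) (e : rel 'I_n).

Let L : 'M[R]_n := laplacian R e.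

Lemma laplacianE (y : 'cV[R]_n) u :
  (L *m y) u 0 = #|[set v | e u v]|%:R * y u 0 - \sum_(v | e u v) y v 0.
Proof.
rewrite /L /laplacian mulmxBl /degree_mx mul_diag_mx !mxE; congr (_ - _).
rewrite [RHS]big_mkcond; apply: eq_bigr => v _.
by rewrite mxE; case: (e u v); rewrite ?mul1r ?mul0r.
Qed.

Lemma laplacian_sym : symmetric e -> L^T = L.
Proof.
move=> e_sym; rewrite /L /laplacian linearB /= /degree_mx tr_diag_mx.
by congr (_ - _); apply/matrixP => i j; rewrite !mxE e_sym.
Qed.

Definition vanishes_on (W : {set 'I_n}) (y : 'cV[R]_n) :=
  forall v, v \in W -> y v 0 = 0.

(** Multiplication by this matrix restricts a vector to P, and multiplication
    by its transpose extends a vector on P by zero; every [submx_on] is then a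
    product of matrices ([submx_onE]). *)
Definition coord_mx (P : {set 'I_n}) : 'M[R]_(#|P|, n) :=
  rowsub (fun i : 'I_#|P| => enum_val i) 1%:M.

Lemma submx_onE (P Q : {set 'I_n}) (M : 'M[R]_n) :
  submx_on P Q M = coord_mx P *m M *m (coord_mx Q)^T.
Proof.
apply/matrixP => i j.
rewrite /coord_mx -rowsubE !mxE.
rewrite (bigD1 (enum_val j)) //= big1 => [|k /negPf kj].
  by rewrite !mxE eqxx mulr1 addr0.
by rewrite !mxE eq_sym kj mulr0.
Qed.

Lemma mul_coord_mx (P : {set 'I_n}) (y : 'cV[R]_n) i :
  (coord_mx P *m y) i 0 = y (enum_val i) 0.
Proof. by rewrite /coord_mx -rowsubE mxE. Qed.

Lemma coord_mx_eq0 (P : {set 'I_n}) (y : 'cV[R]_n) :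
  coord_mx P *m y = 0 <-> vanishes_on P y.
Proof.
split=> [y0 v vP | y0].
  have /colP/(_ (enum_rank_in vP v)) := y0.
  by rewrite mul_coord_mx enum_rankK_in // mxE.
by apply/colP => i; rewrite mul_coord_mx y0 ?mxE // enum_valP.
Qed.

Lemma coord_mxTK (P : {set 'I_n}) : coord_mx P *m (coord_mx P)^T = 1%:M.
Proof.
apply/matrixP => i j; rewrite /coord_mx -rowsubE !mxE.
by rewrite eq_sym (inj_eq enum_val_inj).
Qed.

Lemma coord_mxKT (P : {set 'I_n}) (y : 'cV[R]_n) :
  vanishes_on (~: P) y -> (coord_mx P)^T *m (coord_mx P *m y) = y.
Proof.
move=> y0; apply/colP => v; rewrite mxE.
case: (boolP (v \in P)) => vP.
  rewrite (bigD1 (enum_rank_in vP v)) //= big1 => [|i iv].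
    by rewrite mul_coord_mx !mxE enum_rankK_in // eqxx mul1r addr0.
  rewrite !mxE; case: eqP => [vi|_]; last by rewrite mul0r.
  by case/eqP: iv; apply: enum_val_inj; rewrite enum_rankK_in.
rewrite y0 ?inE // big1 // => i _; rewrite !mxE.
case: eqP => [vi|_]; last by rewrite mul0r.
by rewrite -vi enum_valP in vP.
Qed.

Lemma coord_mxT_vanishes (P : {set 'I_n}) (x : 'cV[R]_#|P|) :
  vanishes_on (~: P) ((coord_mx P)^T *m x).
Proof.
move=> v; rewrite inE => vP; rewrite mxE big1 // => i _; rewrite !mxE.
case: eqP => [vi|_]; last by rewrite mul0r.
by rewrite -vi enum_valP in vP.
Qed.

(** The first two blocks of the controllability matrix are present as soon as
    N >= 2; for N = 1 the second one is missing, but then A is a scalar. *)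
Lemma mul_powers_low N p (A : 'M[R]_N) (B : 'M[R]_(N, p)) (x : 'rV[R]_N) :
  (forall k : 'I_N, x *m (A ^+ k *m B) = 0) ->
  x *m B = 0 /\ x *m (A *m B) = 0.
Proof.
case: N A B x => [|[|N]] A B x xAB.
- by rewrite [x]thinmx0 !mul0mx.
- have xB : x *m B = 0 by have := xAB ord0; rewrite expr0 mul1mx.
  split=> //; rewrite [A]mx11_scalar mul_scalar_mx -scalemxAr xB.
  by rewrite scaler0.
have := xAB (lift ord0 ord0); have := xAB ord0.
by rewrite expr0 mul1mx expr1.
Qed.

(** A row vector x that kills the controllability matrix, extended by zero to
    y, satisfies three conditions: y is zero on W by construction, x B = 0
    says that L y is zero on W, and then L y is the extension of x A, so that
    x A B = 0 says that L (L y) is zero on W. *)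
Lemma controllable_of_observable (W : {set 'I_n}) : symmetric e ->
  (forall y, vanishes_on W y -> vanishes_on W (L *m y) ->
     vanishes_on W (L *m (L *m y)) -> y = 0) ->
  controllable R e W.
Proof.
move=> e_sym obs; rewrite /controllable -/L.
set A := submx_on _ _ _; set B := submx_on _ _ _.
rewrite -kermx_eq0; apply/rowV0P => x /sub_kermxP.
rewrite mul_mxrow -[RHS]mxrow0 => /eq_mxrowP /mul_powers_low[xB xAB].
have LT := laplacian_sym e_sym.
pose y := (coord_mx (~: W))^T *m x^T.
have yW : vanishes_on W y.
  by have := coord_mxT_vanishes x^T; rewrite setCK.
have LyW : vanishes_on W (L *m y).
  apply/coord_mx_eq0/trmx_inj; rewrite trmx0 -[RHS]xB /B submx_onE.
  by rewrite !trmx_mul !trmxK LT -!mulmxA.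
have Ly : L *m y = (coord_mx (~: W))^T *m (x *m A)^T.
  rewrite -[LHS](@coord_mxKT (~: W)) ?setCK //; congr (_ *m _).
  by rewrite /A submx_onE !trmx_mul !trmxK LT -!mulmxA.
have LLyW : vanishes_on W (L *m (L *m y)).
  apply/coord_mx_eq0/trmx_inj; rewrite trmx0 -[RHS]xAB mulmxA Ly /B submx_onE.
  by rewrite !trmx_mul !trmxK LT -!mulmxA.
have /(congr1 (mulmx (coord_mx (~: W)))) := obs y yW LyW LLyW.
rewrite mulmx0 mulmxA coord_mxTK mul1mx => /(congr1 trmx).
by rewrite trmxK trmx0.
Qed.

(** The restriction of y to the followers is a left eigenvector of A that is
    killed by B, hence by every A ^ k B. *)
Lemma controllable_eigenvector (W : {set 'I_n}) (y : 'cV[R]_n) :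
  symmetric e -> controllable R e W ->
  is_eigenvector L y -> vanishes_on W y -> False.
Proof.
move=> e_sym; rewrite /controllable -/L.
set A := submx_on _ _ _; set B := submx_on _ _ _.
move=> /row_free_inj inj [/eqP y_neq0 [a Ly]] yW; apply: y_neq0.
have LT := laplacian_sym e_sym.
have yFW : vanishes_on (~: ~: W) y by rewrite setCK.
pose x := (coord_mx (~: W) *m y)^T.
have yL : y^T *m L = a *: y^T by rewrite -{1}LT -trmx_mul Ly linearZ.
have xF : x *m coord_mx (~: W) = y^T.
  by apply: trmx_inj; rewrite trmx_mul /x !trmxK coord_mxKT.
have xA : x *m A = a *: x.
  by rewrite /A submx_onE !mulmxA xF yL -scalemxAl /x trmx_mul.
have xB : x *m B = 0.
  rewrite /B submx_onE !mulmxA xF yL -scalemxAl -trmx_mul.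
  by rewrite (coord_mx_eq0 W y).2 // trmx0 scaler0.
have xAk k : x *m A ^+ k = a ^+ k *: x.
  elim: k => [|k IHk]; first by rewrite !expr0 mulmx1 scale1r.
  by rewrite exprSr [_ * A]/(_ *m A) mulmxA IHk -scalemxAl xA scalerA -exprSr.
have x0 : x = 0.
  apply: (inj 1%N); rewrite mul0mx mul_mxrow -[RHS]mxrow0.
  by apply/eq_mxrowP => k; rewrite mulmxA xAk -scalemxAl xB scaler0.
by apply: trmx_inj; rewrite trmx0 -xF x0 mul0mx.
Qed.

End Control.

(** * Graphs of hubs and twin leaves *)

Section Triangular.

Local Open Scope ring_scope.

(** A bipartite graph between m hubs and m pairs of leaves, where the leaves of
    a pair have the same neighbours.  The last two fields say that the
    hub-by-pair adjacency matrix is upper triangular with unit diagonal. *)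
Record twin_triangular (n m : nat) (e : rel 'I_n)
    (hub : 'I_m -> 'I_n) (leaf : 'I_m -> bool -> 'I_n) : Prop := {
  hub_or_leaf : forall v, (exists k, v = hub k) \/ (exists k b, v = leaf k b);
  leaf_inj : forall k l b c, leaf k b = leaf l c -> k = l /\ b = c;
  edge_sym : symmetric e;
  hub_hub : forall k l, e (hub k) (hub l) = false;
  leaf_leaf : forall k l b c, e (leaf k b) (leaf l c) = false;
  hub_twins : forall k l, e (hub k) (leaf l false) = e (hub k) (leaf l true);
  hub_own_leaf : forall k b, e (hub k) (leaf k b);
  hub_leaf_le : forall k l b, e (hub k) (leaf l b) -> (k <= l)%N }.

Variables (R : realType) (n m : nat) (e : rel 'I_n).
Variables (hub : 'I_m -> 'I_n) (leaf : 'I_m -> bool -> 'I_n).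
Hypothesis eP : twin_triangular e hub leaf.

Let L : 'M[R]_n := laplacian R e.

Definition leaf_pair k : {set 'I_n} := [set leaf k false; leaf k true].

Definition leaf_choice (f : {ffun 'I_m -> bool}) : {set 'I_n} :=
  [set leaf k (f k) | k : 'I_m].

Lemma leaf_in_pair k b : leaf k b \in leaf_pair k.
Proof. by rewrite !inE; case: b; rewrite eqxx ?orbT. Qed.

Lemma leaf_eqE k l b c : (leaf k b == leaf l c) = (k == l) && (b == c).
Proof.
apply/eqP/andP => [/(leaf_inj eP)[-> ->] // | [/eqP-> /eqP->] //].
Qed.

Lemma card_leaf_pair k : #|leaf_pair k| = 2.
Proof. by rewrite cards2 leaf_eqE eqxx. Qed.

Lemma neighbour_sum0 (y : 'cV[R]_n) u :
  y u 0 = 0 -> (L *m y) u 0 = 0 -> \sum_(v | e u v) y v 0 = 0.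
Proof.
move=> yu; rewrite laplacianE yu mulr0 sub0r => /eqP.
by rewrite oppr_eq0 => /eqP.
Qed.

(** Forward substitution: at the leaf of W in the k-th pair, y is summed over
    hub k and hubs of smaller index. *)
Lemma hubs_vanish (W : {set 'I_n}) (y : 'cV[R]_n) :
  (forall k, exists b, leaf k b \in W) ->
  vanishes_on W y -> vanishes_on W (L *m y) -> forall k, y (hub k) 0 = 0.
Proof.
move=> W_meets yW LyW k.
have [N] := ubnP (k : nat); elim: N k => // N IHN k leN.
have [b bW] := W_meets k.
have := neighbour_sum0 (yW _ bW) (LyW _ bW).
rewrite (bigD1 (hub k)) /=; last by rewrite (edge_sym eP) (hub_own_leaf eP).
rewrite big1 ?addr0 // => v /andP[ev v_neq].
case: (hub_or_leaf eP v) ev v_neq => [[l ->]|[l [c ->]]];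
  last by rewrite (leaf_leaf eP).
rewrite (edge_sym eP) => /(hub_leaf_le eP) le_lk kl.
apply: IHN; rewrite ltnS in leN; apply: leq_trans leN.
rewrite ltn_neqAle le_lk andbT.
by apply: contraNneq kl => /val_inj ->.
Qed.

(** Backward substitution: at hub k, y is summed over the k-th pair, one of
    whose leaves lies in W, and over leaves of pairs of larger index. *)
Lemma leaves_vanish (W : {set 'I_n}) (y : 'cV[R]_n) :
  (forall k, exists b, leaf k b \in W) -> vanishes_on W y ->
  (forall k, y (hub k) 0 = 0) -> (forall k, (L *m y) (hub k) 0 = 0) ->
  forall k b, y (leaf k b) 0 = 0.
Proof.
move=> W_meets yW yhub Lyhub k.
have [N] := ubnP (m - k)%N; elim: N k => // N IHN k leN.
have [b bW] := W_meets k.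
have := neighbour_sum0 (yhub k) (Lyhub k).
rewrite (bigD1 (leaf k b)) ?(hub_own_leaf eP) //= yW // add0r.
rewrite (bigD1 (leaf k (~~ b))) ?(hub_own_leaf eP) //=; last first.
  by rewrite leaf_eqE eqxx; case: (b).
rewrite big1 ?addr0 => [y0 c|v /andP[/andP[ev vb] vNb]].
  have [->|/negPf cb] := eqVneq c b; first exact: yW.
  by move: y0; case: (b) (c) cb => [] [].
case: (hub_or_leaf eP v) ev vb vNb => [[l ->]|[l [c ->]]];
  first by rewrite (hub_hub eP).
move=> /(hub_leaf_le eP) le_kl; rewrite !leaf_eqE => lb lNb.
have lk : l != k.
  apply: contraNneq lb => lk; move: lNb.
  by rewrite lk eqxx; case: (b) (c) => [] [].
apply: IHN; have := ltn_ord l.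
have : (l : nat) <> k by move/val_inj/eqP; apply/negP.
move: le_kl leN; lia.
Qed.

Lemma meets_pairs_observable (W : {set 'I_n}) (y : 'cV[R]_n) :
  (forall k, exists b, leaf k b \in W) ->
  vanishes_on W y -> vanishes_on W (L *m y) -> vanishes_on W (L *m (L *m y)) ->
  y = 0.
Proof.
move=> W_meets yW LyW LLyW.
have yhub := hubs_vanish W_meets yW LyW.
have yleaf := leaves_vanish W_meets yW yhub (hubs_vanish W_meets LyW LLyW).
apply/colP => v; rewrite mxE.
by case: (hub_or_leaf eP v) => [[k ->]|[k [b ->]]].
Qed.

Definition twin_vec k : 'cV[R]_n :=
  delta_mx (leaf k false) 0 - delta_mx (leaf k true) 0.

Lemma twin_vecE k v : twin_vec k v 0 =
  (v == leaf k false)%:R - (v == leaf k true)%:R.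
Proof. by rewrite !mxE eqxx !andbT. Qed.

Lemma leaf_twins u k : e u (leaf k false) = e u (leaf k true).
Proof.
case: (hub_or_leaf eP u) => [[l ->]|[l [b ->]]]; first exact: (hub_twins eP).
by rewrite !(leaf_leaf eP).
Qed.

(** The contributions of the twins cancel at each common neighbour, and the two
    leaves have the same degree, which is the eigenvalue. *)
Lemma twin_vec_eigenvector k : is_eigenvector L (twin_vec k).
Proof.
split.
  apply/eqP => /colP/(_ (leaf k false))/eqP.
  by rewrite twin_vecE mxE !leaf_eqE !eqxx subr0 oner_eq0.
exists #|[set v | e (leaf k false) v]|%:R; apply/colP => u.
rewrite laplacianE [RHS]mxE big_mkcond /= (bigD1 (leaf k false)) //=.
rewrite (bigD1 (leaf k true)) /=; last by rewrite leaf_eqE eqxx.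
rewrite big1 => [|v /andP[/negPf v0 /negPf v1]]; last first.
  by rewrite twin_vecE v0 v1 subr0 if_same.
rewrite -leaf_twins !twin_vecE !leaf_eqE !eqxx /= subr0 sub0r addr0.
have -> : (if e u (leaf k false) then 1 else 0) +
          (if e u (leaf k false) then -1 else 0) = 0 :> R.
  by case: ifP => _; rewrite ?subrr ?addr0.
rewrite subr0; have [-> //|u0] := eqVneq u (leaf k false).
have [->|u1] := eqVneq u (leaf k true); last by rewrite subr0 !mulr0.
congr (_%:R * _); apply: eq_card => v.
by rewrite !inE !(edge_sym eP _ v) leaf_twins.
Qed.

Lemma twin_vec_support k v : (twin_vec k v 0 != 0) = (v \in leaf_pair k).
Proof.
rewrite twin_vecE !inE; have [->|v0] := eqVneq v (leaf k false).
  by rewrite leaf_eqE eqxx subr0 oner_eq0.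
have [_|_] := eqVneq v (leaf k true).
  by rewrite sub0r oppr_eq0 oner_eq0.
by rewrite subrr eqxx.
Qed.

Lemma pcs_leaf_pair k : pcs R e (leaf_pair k).
Proof.
split; first by rewrite -card_gt0 card_leaf_pair.
exists (twin_vec k); split; first exact: twin_vec_eigenvector.
  by move=> v; rewrite -twin_vec_support negbK => /eqP.
by move=> v; rewrite twin_vec_support.
Qed.

Lemma meets_pairsP (W : {set 'I_n}) :
  (forall k, exists b, leaf k b \in W) \/ exists k, [disjoint leaf_pair k & W].
Proof.
case: (boolP [forall k, [exists b, leaf k b \in W]]) => [/forallP W_meets|].
  by left=> k; apply/existsP.
rewrite negb_forall => /existsP[k]; rewrite negb_exists => /forallP kW.
right; exists k; rewrite disjoint_subset; apply/subsetP => v.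
by rewrite !inE => /orP[] /eqP ->.
Qed.

(** Otherwise the complement of S meets every pair, and the eigenvector
    supported on S is zero by [meets_pairs_observable]. *)
Lemma pcs_contains_pair (S : {set 'I_n}) :
  pcs R e S -> exists k, leaf_pair k \subset S.
Proof.
move=> [_ [y [[y_neq0 [a Ly]] yS _]]].
have [W_meets|[k kS]] := meets_pairsP (~: S); last first.
  by exists k; rewrite disjoints_subset setCK in kS.
have yW : vanishes_on (~: S) y by move=> v; rewrite inE; apply: yS.
have ZW b : vanishes_on (~: S) (b *: y).
  by move=> v vS; rewrite mxE yW ?mulr0.
(* L y and L (L y) are multiples of y. *)
case/eqP: y_neq0; apply: (meets_pairs_observable W_meets) => //.
  by rewrite /L Ly; apply: ZW.
by rewrite /L Ly -scalemxAr Ly scalerA; apply: ZW.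
Qed.

(** All pairs have the same cardinality, so none contains another properly. *)
Lemma minimal_pcsP (S : {set 'I_n}) :
  minimal_pcs R e S <-> exists k, S = leaf_pair k.
Proof.
split=> [[pcsS minS] | [k ->]].
  have [k kS] := pcs_contains_pair pcsS; exists k; apply/eqP.
  rewrite eq_sym; apply: contraT => neq.
  by case: (minS (leaf_pair k)); rewrite ?properEneq ?neq //;
    apply: pcs_leaf_pair.
split=> [|S' S'k /pcs_contains_pair[l lS']]; first exact: pcs_leaf_pair.
have /proper_card := sub_proper_trans lS' S'k.
by rewrite !card_leaf_pair.
Qed.

Lemma controllableP (W : {set 'I_n}) :
  controllable R e W <-> forall k, exists b, leaf k b \in W.
Proof.
split=> [ctrlW | W_meets].
  have [//|[k kW]] := meets_pairsP W.
  case: (controllable_eigenvector (edge_sym eP) ctrlW (twin_vec_eigenvector k)).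
  move=> v vW; apply/eqP; rewrite -[_ == _]negbK twin_vec_support.
  by rewrite (disjointFl kW).
apply: controllable_of_observable (edge_sym eP) _ => y.
exact: meets_pairs_observable.
Qed.

Lemma card_leaf_choice f : #|leaf_choice f| = m.
Proof.
by rewrite card_imset ?card_ord // => k l /(leaf_inj eP)[].
Qed.

Lemma leaf_choice_inj : injective leaf_choice.
Proof.
move=> f1 f2 eqf; apply/ffunP => k.
have : leaf k (f1 k) \in leaf_choice f2 by rewrite -eqf; apply/imsetP; exists k.
by case/imsetP => l _ /(leaf_inj eP)[-> ->].
Qed.

Lemma leaf_choice_controllable f : controllable R e (leaf_choice f).
Proof. by apply/controllableP => k; exists (f k); apply/imsetP; exists k. Qed.

Lemma controllable_leaf_choice (W : {set 'I_n}) :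
  controllable R e W -> exists f, leaf_choice f \subset W.
Proof.
move=> /controllableP W_meets.
(* When the true leaf is not in W, the false one is. *)
exists [ffun k => leaf k true \in W]; apply/subsetP => _ /imsetP[k _ ->].
rewrite ffunE; have [b] := W_meets k.
by case: (boolP (leaf k true \in W)) b => // /negPf kW [] //; rewrite kW.
Qed.

Lemma min_leaders (W : {set 'I_n}) : controllable R e W -> (m <= #|W|)%N.
Proof.
move=> /controllable_leaf_choice[f /subset_leq_card].
by rewrite card_leaf_choice.
Qed.

Lemma card_min_leaders :
  #|[set W : {set 'I_n} | controllable R e W & #|W| == m]| = (2 ^ m)%N.
Proof.
have <- : #|{ffun 'I_m -> bool}| = (2 ^ m)%N.
  by rewrite card_ffun card_bool card_ord.
rewrite -cardsT -(card_imset (mem setT) leaf_choice_inj).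
apply: eq_card => W; rewrite inE; apply/andP/imsetP => [[]|[f _ ->]].
  move=> /controllable_leaf_choice[f fW] /eqP cW; exists f => //.
  by apply/eqP; rewrite eq_sym eqEcard fW card_leaf_choice cW /=.
by rewrite leaf_choice_controllable card_leaf_choice.
Qed.

End Triangular.

(** * The edges of the deterministic scale-free network *)

Section Dsfn.

Local Open Scope nat_scope.

(** The other leaf of the pair {3k - 1, 3k}, when b is a leaf label. *)
Definition twin_label (b : nat) : nat := if b %% 3 == 2 then b.+1 else b.-1.

Definition leaf_labels (B : seq nat) : Prop := forall b, b \in B ->
  [/\ 1 < b, b %% 3 != 1 & twin_label b \in B].

(** The construction preserves this invariant because its shifts are multiples
    of 3, except in the first step, where the shifted lists are empty. *)
Definition hub_leaf_edges (E : seq (nat * nat)) : Prop := forall a b,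
  (a, b) \in E ->
  [/\ a %% 3 = 1, a < b, b %% 3 != 1 & (a, twin_label b) \in E].

Lemma twin_label_leaf k (b : bool) :
  twin_label (3 * k + 2 + b) = 3 * k + 2 + ~~ b.
Proof. by rewrite /twin_label -addnA mulnC modnMDl; case: b => /=; lia. Qed.

Lemma twin_label_shift d b : 3 %| d -> 0 < b -> b %% 3 != 1 ->
  (d + b) %% 3 != 1 /\ twin_label (d + b) = d + twin_label b.
Proof.
move=> /dvdnP[c ->] b_gt0 b1; rewrite /twin_label modnMDl b1; split=> //.
by case: ifP => _; lia.
Qed.

Lemma leaf_labels_shift d B :
  3 %| d -> leaf_labels B -> leaf_labels (shift_labels d B).
Proof.
move=> d3 BP _ /mapP[b bB ->]; have [b_gt1 b1 tb] := BP _ bB.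
have [db1 ->] := twin_label_shift d3 (ltnW b_gt1) b1.
by split=> //; [lia | apply: map_f].
Qed.

Lemma leaf_labels_cat B1 B2 :
  leaf_labels B1 -> leaf_labels B2 -> leaf_labels (B1 ++ B2).
Proof.
move=> B1P B2P b; rewrite mem_cat => /orP[/B1P | /B2P] [b_gt1 b1 tb].
  by split=> //; rewrite mem_cat tb.
by split=> //; rewrite mem_cat tb orbT.
Qed.

Lemma dsfn_bottom_leaf_labels h : leaf_labels (dsfn_bottom h.+1).
Proof.
elim: h => [|h IHh]; first by move=> b; rewrite !inE => /orP[] /eqP ->.
have d3 : 3 %| 3 ^ h.+1 by rewrite expnS dvdn_mulr.
by apply: leaf_labels_cat; apply: leaf_labels_shift => //; apply: dvdn_mull.
Qed.

Lemma hub_leaf_edges_shift d E :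
  3 %| d -> hub_leaf_edges E -> hub_leaf_edges (shift_edges d E).
Proof.
move=> d3 EP a b /mapP[[a' b'] abE [-> ->]] /=.
have [a1 ab b1 tb] := EP _ _ abE.
have [db1 ->] := twin_label_shift d3 (leq_ltn_trans (leq0n _) ab) b1.
split=> //; last exact: (map_f _ tb); last by rewrite ltn_add2l.
by case/dvdnP: d3 => c ->; rewrite modnMDl.
Qed.

Lemma hub_leaf_edges_cat E1 E2 :
  hub_leaf_edges E1 -> hub_leaf_edges E2 -> hub_leaf_edges (E1 ++ E2).
Proof.
move=> E1P E2P a b; rewrite mem_cat => /orP[/E1P | /E2P] [a1 ab b1 tb].
  by split=> //; rewrite mem_cat tb.
by split=> //; rewrite mem_cat tb orbT.
Qed.

Lemma hub_leaf_edges_root B :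
  leaf_labels B -> hub_leaf_edges [seq (1, b) | b <- B].
Proof.
move=> BP a b /mapP[c cB [-> ->]]; have [b_gt1 b1 tb] := BP _ cB.
by split=> //; apply: map_f.
Qed.

Lemma dsfn_edgesS h : dsfn_edges h.+1 =
  dsfn_edges h ++ shift_edges (3 ^ h) (dsfn_edges h)
    ++ shift_edges (2 * 3 ^ h) (dsfn_edges h)
    ++ [seq (1, b) | b <- dsfn_bottom h.+1].
Proof. by []. Qed.

Lemma dsfn_hub_leaf_edges g : hub_leaf_edges (dsfn_edges g).
Proof.
elim: g => [//|h IHh]; rewrite dsfn_edgesS.
have shiftP d : d \in [:: 3 ^ h; 2 * 3 ^ h] ->
    hub_leaf_edges (shift_edges d (dsfn_edges h)).
  case: h IHh => [_ _ // | h IHh d_in]; apply: hub_leaf_edges_shift => //.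
  by move: d_in; rewrite !inE => /orP[] /eqP ->;
    rewrite ?dvdn_mull // expnS dvdn_mulr.
apply: hub_leaf_edges_cat => //.
apply: hub_leaf_edges_cat; first by apply: shiftP; rewrite !inE eqxx.
apply: hub_leaf_edges_cat; first by apply: shiftP; rewrite !inE eqxx orbT.
exact/hub_leaf_edges_root/(@dsfn_bottom_leaf_labels h).
Qed.

Lemma mem_dsfn_edgesS h x : (x \in dsfn_edges h.+1) =
  [|| x \in dsfn_edges h, x \in shift_edges (3 ^ h) (dsfn_edges h),
      x \in shift_edges (2 * 3 ^ h) (dsfn_edges h)
    | x \in [seq (1, b) | b <- dsfn_bottom h.+1]].
Proof.
rewrite dsfn_edgesS; move: (dsfn_edges h) (dsfn_bottom _) => E B.
by rewrite !mem_cat.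
Qed.

(** The index k, written in base 3, is located in one of the three copies of
    the previous generation by its leading digit. *)
Lemma dsfn_hub_own_leaf h k : k < 3 ^ h ->
  (3 * k + 1, 3 * k + 2) \in dsfn_edges h.+1.
Proof.
elim: h k => [[|k] //|h IHh k k_lt]; rewrite mem_dsfn_edgesS.
have shift c l : l < 3 ^ h ->
    (3 * (c * 3 ^ h + l) + 1, 3 * (c * 3 ^ h + l) + 2)
      \in shift_edges (c * 3 ^ h.+1) (dsfn_edges h.+1).
  move=> l_lt; apply/mapP; exists (3 * l + 1, 3 * l + 2); first exact: IHh.
  by rewrite expnS /=; congr (_, _); lia.
have [k0 | k0] := ltnP k (3 ^ h); first by rewrite IHh.
have [k1 | k1] := ltnP k (2 * 3 ^ h).
  have := shift 1 (k - 3 ^ h); rewrite !mul1n subnKC // => ->; last lia.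
  by rewrite orbT.
have := shift 2 (k - 2 * 3 ^ h); rewrite subnKC // => ->.
  by rewrite !orbT.
by move: k_lt; rewrite expnS; lia.
Qed.

(** Ordinals are one less than labels: hub k has label 3k + 1 and its leaves
    have labels 3k + 2 and 3k + 3, for k counted from 0. *)
Fact hub_subproof h (k : 'I_(3 ^ h)) : 3 * k < 3 ^ h.+1.
Proof. by have := ltn_ord k; rewrite expnS; lia. Qed.

Fact leaf_subproof h (k : 'I_(3 ^ h)) (b : bool) : 3 * k + 1 + b < 3 ^ h.+1.
Proof. by have := ltn_ord k; rewrite expnS; case: b; lia. Qed.

Definition dsfn_hub h (k : 'I_(3 ^ h)) : 'I_(3 ^ h.+1) :=
  Ordinal (hub_subproof k).

Definition dsfn_leaf h (k : 'I_(3 ^ h)) (b : bool) : 'I_(3 ^ h.+1) :=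
  Ordinal (leaf_subproof k b).

Lemma dsfn_hub_leafE h (k l : 'I_(3 ^ h)) b :
  dsfn h.+1 (dsfn_hub k) (dsfn_leaf l b) =
  ((3 * k + 1, 3 * l + 2 + b) \in dsfn_edges h.+1).
Proof.
have kE : label (dsfn_hub k) = 3 * k + 1 by rewrite /label /= addn1.
have lE : label (dsfn_leaf l b) = 3 * l + 2 + b by rewrite /label /=; lia.
rewrite /dsfn kE lE; apply: orb_idr => /dsfn_hub_leaf_edges[l1 _ k1 _].
by move: k1; rewrite mulnC modnMDl.
Qed.

Lemma dsfn_twin_triangular h :
  twin_triangular (dsfn h.+1) (@dsfn_hub h) (@dsfn_leaf h).
Proof.
have edgesP := @dsfn_hub_leaf_edges h.+1.
split.
- move=> v.
  have v3 : v %/ 3 < 3 ^ h by rewrite ltn_divLR // mulnC -expnS.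
  have := ltn_pmod v (isT : 0 < 3); have := divn_eq v 3.
  case: (v %% 3) => [|[|[|//]]] vE _; [left | right | right].
  + by exists (Ordinal v3); apply: val_inj; rewrite /= mulnC vE addn0 mulnK.
  + by exists (Ordinal v3), false; apply: val_inj; move: vE => /=; lia.
  + by exists (Ordinal v3), true; apply: val_inj; move: vE => /=; lia.
- move=> k l b c /(congr1 val) /= kl.
  have /val_inj-> : val k = val l by move: kl; case: (b); case: (c) => /=; lia.
  by split=> //; move: kl; case: (b) (c) => [] [] //=; lia.
- by move=> u v; rewrite /dsfn orbC.
- move=> k l; apply/negP => /orP[] /edgesP[_ _];
    by rewrite /label /= -addn1 mulnC modnMDl.
- move=> k l b c; apply/negP => /orP[] /edgesP[a1 _ _ _]; move: a1;
    by rewrite /label /= -addnS -addnA mulnC modnMDl; case: (b) (c) => [] [].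
- move=> k l; rewrite !dsfn_hub_leafE.
  by apply/idP/idP => /edgesP[_ _ _]; rewrite twin_label_leaf.
- move=> k b; rewrite dsfn_hub_leafE.
  have own := dsfn_hub_own_leaf (ltn_ord k).
  case: b; last by rewrite addn0.
  have /edgesP[_ _ _] := own.
  by have := twin_label_leaf k false; rewrite addn0 => ->.
move=> k l b; rewrite dsfn_hub_leafE => /edgesP[_ ltkl _ _].
by move: ltkl; case: b; lia.
Qed.

Lemma dsfn_leaf_pairE h (k : 'I_(3 ^ h)) :
  leaf_pair (@dsfn_leaf h) k =
  [set v : 'I_(3 ^ h.+1) | label v \in [:: 3 * k.+1 - 1; 3 * k.+1]].
Proof.
apply/setP => v; rewrite !inE -!val_eqE /label /=.
by congr orb; apply/eqP/eqP; lia.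
Qed.

End Dsfn.

Theorem mainTheorem4 (R : realType) (g : nat) (hg : 1 <= g) :
  [/\ (forall S : {set 'I_(3 ^ g)},
         minimal_pcs R (dsfn g) S <->
         exists2 k : nat, 1 <= k <= 3 ^ (g - 1) &
           S = [set v : 'I_(3 ^ g) | label v \in [:: 3 * k - 1; 3 * k]]),
      ((exists2 W : {set 'I_(3 ^ g)},
          controllable R (dsfn g) W & #|W| = 3 ^ (g - 1)) /\
       (forall W : {set 'I_(3 ^ g)},
          controllable R (dsfn g) W -> 3 ^ (g - 1) <= #|W|))
    & #|[set W : {set 'I_(3 ^ g)} |
          controllable R (dsfn g) W & #|W| == 3 ^ (g - 1)]|
      = 2 ^ (3 ^ (g - 1))].
Proof.
case: g hg => [//|h] _; rewrite subSS subn0.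
have DP := dsfn_twin_triangular h.
split; last exact: card_min_leaders DP.
  move=> S; split=> [/(minimal_pcsP R DP)[k ->] | [k k_bd SE]].
    by exists k.+1; [rewrite ltn_ord | apply: dsfn_leaf_pairE].
  apply/(minimal_pcsP R DP).
  have k_lt : k.-1 < 3 ^ h by move: k_bd; lia.
  exists (Ordinal k_lt); rewrite dsfn_leaf_pairE SE /= prednK //.
  by case/andP: k_bd.
split; last exact: min_leaders DP.
exists (leaf_choice (@dsfn_leaf h) [ffun=> false]).
  exact: leaf_choice_controllable DP _.
exact: card_leaf_choice DP _.
Qed.
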